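(* Let $\xi_1,\dots,\xi_n$ be non-zero $\mathbb{Z}$-linear forms on $\mathbb{Z}^r$, put $\xi=(\xi_1,\dots,\xi_n)$ and $S=\{x\in\mathbb{Z}^r: \xi_i(x)\ge 0,\ i=1,\dots,n\}$, and suppose that $S$ is positive and $\operatorname{gp}(S)=\mathbb{Z}^r$. Let $K$ be a field and $R=K[S]$. Then for every $m\in\mathbb{Z}_+$ there exist only finitely many isomorphism classes (as $R$-modules) of $\xi$-convex ideals such that a representative $I$ has $\mu(I)\le m$.
   Context: $\operatorname{gp}(S)$ is the group of differences of $S$; $S$ is positive if $0$ is its only invertible element. For $a\in\mathbb{Z}^n$ let $T(a;\xi)=\{x\in\mathbb{Z}^r: \xi_i(x)\ge a_i,\ i=1,\dots,n\}$ and let $I(a;\xi)=K\,T(a;\xi)\subset K[\mathbb{Z}^r]$ be the $K$-vector space with basis the monomials in $T(a;\xi)$; it is a non-zero fractional ideal of $R$. The fractional ideals $I(a;\xi)$, $a\in\mathbb{Z}^n$, are called $\xi$-convex ideals. $\mu(I)$ is the minimal number of generators of $I$ as an $R$-module. *)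

(* Defs.v *)
From HB Require Import structures.
From mathcomp Require Import all_boot all_order all_algebra finmap.
From mathcomp Require Import boolp classical_sets functions cardinality.
From mathcomp Require Import monalg.

Set Implicit Arguments.
Unset Strict Implicit.
Unset Printing Implicit Defensive.

Import Order.TTheory GRing.Theory Num.Theory.
Local Open Scope ring_scope.

(* The group algebra K[G] of an additively written abelian group G: finitely
   supported functions G -> K, where << x >> is the monomial of x.  The library
   only multiplies in {malg K[M]} for a monoid M without invertible elements,
   so the convolution product is put on an alias of {malg K[G]}. *)
Definition grpalg (K : fieldType) (G : zmodType) := {malg K[G]}.

HB.instance Definition _ (K : fieldType) (G : zmodType) :=
  GRing.Lmodule.on (grpalg K G).

Section GroupAlgebra.
Context (K : fieldType) (G : zmodType).
Implicit Types f g h : grpalg K G.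

Definition ga_one : grpalg K G := << (0 : G) >>.

Definition ga_mul f g : grpalg K G :=
  \sum_(x <- msupp f) \sum_(y <- msupp g) << f@_x * g@_y *g x + y >>.

Lemma ga_mulw (d1 d2 : {fset G}) f g :
  (msupp f `<=` d1 -> msupp g `<=` d2 ->
  ga_mul f g = \sum_(x <- d1) \sum_(y <- d2) << f@_x * g@_y *g x + y >>)%fset.
Proof.
move=> le_d1 le_d2; rewrite /ga_mul (big_fset_incl _ le_d1) /=.
  apply/eq_bigr=> x _; apply/big_fset_incl => // y _ /mcoeff_outdom ->.
  by rewrite mulr0 monalgU0.
move=> x _ /mcoeff_outdom fx.
by rewrite big1 // => y _; rewrite fx mul0r monalgU0.
Qed.

Lemma ga_mulC : commutative ga_mul.
Proof.
move=> f g; rewrite /ga_mul exchange_big /=; apply: eq_bigr => x _.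
by apply: eq_bigr => y _; rewrite mulrC addrC.
Qed.

Lemma ga_mul0g : left_zero 0 ga_mul.
Proof. by move=> g; rewrite /ga_mul msupp0 big_seq_fset0. Qed.

Lemma ga_mulDl : left_distributive ga_mul +%R.
Proof.
move=> f g h.
rewrite [in RHS](ga_mulw (fsubsetUl _ (msupp g)) (fsubset_refl _)).
rewrite [in RHS](ga_mulw (fsubsetUr (msupp f) _) (fsubset_refl _)).
rewrite (ga_mulw (msuppD_le _ _) (fsubset_refl _)).
rewrite -big_split /=; apply/eq_bigr=> x _.
rewrite -big_split /=; apply/eq_bigr=> y _.
by rewrite mcoeffD mulrDl monalgUD.
Qed.

Lemma ga_mulDr : right_distributive ga_mul +%R.
Proof. by move=> f g h; rewrite !(ga_mulC f) ga_mulDl. Qed.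

Lemma ga_mulg0 : right_zero 0 ga_mul.
Proof. by move=> g; rewrite ga_mulC ga_mul0g. Qed.

Lemma ga_mulUg (c : K) x g :
  ga_mul << c *g x >> g = \sum_(y <- msupp g) << c * g@_y *g x + y >>.
Proof.
rewrite (ga_mulw msuppU_le (fsubset_refl _)) big_seq_fset1.
by apply/eq_bigr => y _; rewrite mcoeffUU.
Qed.

Lemma ga_mulUU (c d : K) (x y : G) :
  ga_mul << c *g x >> << d *g y >> = << c * d *g x + y >>.
Proof. by rewrite (ga_mulw msuppU_le msuppU_le) !big_seq_fset1 !mcoeffUU. Qed.

Lemma ga_mulEl f g :
  ga_mul f g = \sum_(x <- msupp f) ga_mul << f@_x *g x >> g.
Proof. by apply/eq_bigr=> x _; rewrite ga_mulUg. Qed.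

Lemma ga_mulEr f g :
  ga_mul f g = \sum_(y <- msupp g) ga_mul f << g@_y *g y >>.
Proof. by rewrite ga_mulC ga_mulEl; apply: eq_bigr => y _; rewrite ga_mulC. Qed.

Lemma ga_mul1g : left_id ga_one ga_mul.
Proof.
move=> g; rewrite ga_mulUg [RHS]monalgE.
by apply/eq_bigr=> y _; rewrite mul1r add0r.
Qed.

Lemma ga_mulA : associative ga_mul.
Proof.
move=> f g h.
rewrite [RHS](big_morph (ga_mul^~ _) (fun _ _ => ga_mulDl _ _ _) (ga_mul0g _)).
rewrite ga_mulEl; apply/eq_bigr=> x _.
rewrite [LHS](big_morph (ga_mul _) (fun _ _ => ga_mulDr _ _ _) (ga_mulg0 _)).
rewrite [RHS](big_morph (ga_mul^~ _) (fun _ _ => ga_mulDl _ _ _) (ga_mul0g _)).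
apply/eq_bigr=> y _.
rewrite [LHS](big_morph (ga_mul _) (fun _ _ => ga_mulDr _ _ _) (ga_mulg0 _)).
by rewrite ga_mulEr; apply/eq_bigr=> z _; rewrite !ga_mulUU mulrA addrA.
Qed.

Lemma ga_one_neq0 : ga_one != 0.
Proof. by rewrite monalgU_eq0 oner_eq0. Qed.

HB.instance Definition _ := GRing.Zmodule_isComNzRing.Build (grpalg K G)
  ga_mulA ga_mulC ga_mul1g ga_mulDl ga_one_neq0.

Lemma ga_scaleAl (c : K) f g : c *: (f * g) = (c *: f) * g.
Proof.
have scaleE h : c *: h = ga_mul << c *g 0 >> h.
  rewrite ga_mulUg malgZ_def; apply: eq_bigr => x _.
  by rewrite add0r.
by rewrite !scaleE; exact: ga_mulA.
Qed.

HB.instance Definition _ := GRing.Lmodule_isLalgebra.Build K (grpalg K G)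
  ga_scaleAl.

(* The K-subspace K T of K[G] spanned by the monomials in T. *)
Definition supported (T : pred G) : {pred grpalg K G} :=
  fun f => all T (msupp f).

Lemma supportedP (T : pred G) f :
  reflect (forall x, f@_x != 0 -> T x) (f \in supported T).
Proof.
apply: (iffP allP) => fT x; first by rewrite mcoeff_neq0 => /fT.
by rewrite -mcoeff_neq0 => /fT.
Qed.

Lemma supported_zmod (T : pred G) : zmod_closed (supported T).
Proof.
split=> [|f g /supportedP fT /supportedP gT]; apply/supportedP => x.
  by rewrite mcoeff0 eqxx.
rewrite mcoeffB; have [/eqP fx0|/fT//] := boolP (f@_x == 0).
by rewrite fx0 sub0r oppr_eq0 => /gT.
Qed.

Lemma supportedM (T1 T2 T : pred G) f g :
    (forall x y, T1 x -> T2 y -> T (x + y)) ->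
  f \in supported T1 -> g \in supported T2 -> f * g \in supported T.
Proof.
move=> T12 /allP fT /allP gT; apply/supportedP => z.
apply: contraNT => zT; apply/eqP; rewrite [_ * _]/(ga_mul f g) /ga_mul.
rewrite raddf_sum big_seq big1 //= => x xf.
rewrite raddf_sum big_seq big1 //= => y yg.
rewrite mcoeffU; case: eqVneq => // xyz.
by rewrite -xyz (T12 _ _ (fT _ xf) (gT _ yg)) in zT.
Qed.

End GroupAlgebra.

Section Semigroup.
Context (G : zmodType) (S : pred G).

Definition gp : set G := [set z | exists x y, [/\ S x, S y & z = x - y]]%classic.

Definition positive : Prop :=
  forall x, S x -> (exists2 y, S y & x + y = 0) -> x = 0.

End Semigroup.

Section ModuleNotions.
Context (R : nzRingType).

Definition generated_by (M : lmodType R) (k : nat) : Prop :=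
  exists g : 'I_k -> M,
    forall x, exists c : 'I_k -> R, x = \sum_(i < k) c i *: g i.

(* mu(M) = k; there is no such k if M is not finitely generated *)
Definition mu_is (M : lmodType R) (k : nat) : Prop :=
  generated_by M k /\ forall j, generated_by M j -> (k <= j)%N.

Definition mod_isomorphic (M N : lmodType R) : Prop :=
  exists f : {linear M -> N}, bijective f.

End ModuleNotions.

Section ConvexIdeals.
Context (K : fieldType) (r n : nat) (xi : 'I_n -> {scalar 'rV[int]_r}).

Local Notation L := (grpalg K 'rV[int]_r).

Definition semigroup : pred 'rV[int]_r := fun x => [forall i, 0 <= xi i x].

Definition convex_set (a : 'rV[int]_n) : pred 'rV[int]_r :=
  fun x => [forall i, a 0 i <= xi i x].

Definition semigroup_ring_pred : {pred L} := supported semigroup.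

Lemma semigroup_ring_pred_subring : subring_closed semigroup_ring_pred.
Proof.
split; last 2 first.
- by have [_] := supported_zmod K semigroup; exact.
- move=> f g; apply: supportedM => x y /forallP Sx /forallP Sy.
  by apply/forallP => i; rewrite raddfD; exact: addr_ge0 (Sx i) (Sy i).
apply/supportedP => x; rewrite [X in X@__]/(ga_one K _) mcoeffU.
have [<- _|_] := eqVneq 0 x; last by rewrite eqxx.
by apply/forallP => i; rewrite raddf0.
Qed.

HB.instance Definition _ :=
  GRing.isSubringClosed.Build L semigroup_ring_pred semigroup_ring_pred_subring.

Definition semigroup_ring : Type := {f : L | f \in semigroup_ring_pred}.

HB.instance Definition _ := SubChoice.on semigroup_ring.
HB.instance Definition _ :=
  [SubChoice_isSubComNzRing of semigroup_ring by <:].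

Local Notation R := semigroup_ring.

(* K[Z^r] seen as a module over its subring R; the phantom argument xi
   determines R. *)
Definition ambient of ('I_n -> {scalar 'rV[int]_r}) : Type := L.

Local Notation M := (ambient xi).

HB.instance Definition _ := GRing.Zmodule.on M.

Definition ambient_scale (s : R) (f : M) : M := (val s : L) * f.

Fact ambient_scaleA s t f :
  ambient_scale s (ambient_scale t f) = ambient_scale (s * t) f.
Proof. by rewrite /ambient_scale rmorphM; exact: (@mulrA L). Qed.

Fact ambient_scale1 : left_id 1 ambient_scale.
Proof. by move=> f; rewrite /ambient_scale rmorph1; exact: (@mul1r L). Qed.

Fact ambient_scaleDr : right_distributive ambient_scale +%R.
Proof. by move=> s f g; exact: (@mulrDr L). Qed.

Fact ambient_scaleDl f : {morph ambient_scale^~ f : s t / s + t}.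
Proof.
by move=> s t; rewrite /ambient_scale rmorphD; exact: (@mulrDl L).
Qed.

HB.instance Definition _ := GRing.Zmodule_isLmodule.Build R M
  ambient_scaleA ambient_scale1 ambient_scaleDr ambient_scaleDl.

Definition convex_ideal_pred (a : 'rV[int]_n) : {pred M} :=
  supported (K := K) (convex_set a).

Lemma convex_ideal_pred_submod a : submod_closed (convex_ideal_pred a).
Proof.
have [I0 IB] := supported_zmod K (convex_set a); split=> // s f g Is Ig.
have IN h : h \in convex_ideal_pred a -> - h \in convex_ideal_pred a.
  by move=> Ih; rewrite -sub0r; exact: IB.
rewrite -[g]opprK; apply: IB; last exact: IN.
apply: (supportedM _ (valP s) Is) => x y /forallP Sx /forallP Ty.
by apply/forallP => i; rewrite raddfD -[leLHS]add0r; exact: lerD (Sx i) (Ty i).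
Qed.

HB.instance Definition _ a := GRing.isSubmodClosed.Build R M
  (convex_ideal_pred a) (convex_ideal_pred_submod a).

Definition convex_ideal (a : 'rV[int]_n) : Type :=
  {f : M | f \in convex_ideal_pred a}.

HB.instance Definition _ a := SubChoice.on (convex_ideal a).
HB.instance Definition _ a := [SubChoice_isSubLmodule of convex_ideal a by <:].

(* The isomorphism class of I(a; xi) among the xi-convex ideals, each of them
   taken as a subset of K[Z^r]: different b may define the same ideal. *)
Definition convex_iso_class (a : 'rV[int]_n) : set (set L) :=
  [set J | exists2 b : 'rV[int]_n, J = [set f | f \in convex_ideal_pred b]
     & mod_isomorphic (convex_ideal a) (convex_ideal b)]%classic.

End ConvexIdeals.

Arguments semigroup_ring K {r n} xi.
Arguments ambient K {r n} xi.
Arguments convex_ideal K {r n} xi a.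
Arguments convex_iso_class K {r n} xi a.

(* Main.v *)
(** An isomorphism class is determined by the set of S-minimal points of
    T(a; xi) up to translation, and there are at most mu(I) of them, since
    f |-> (coefficients at the minimal points) maps I onto K^N and K[S] acts on
    K^N through the constant coefficient.  It remains to bound their mutual
    distances.  Let x0 be the lowest minimal point for the height sum_i xi_i.
    From another minimal point y, one Graver step towards x0 (convexity keeps
    it inside T) reaches a point above some minimal point z, which is lower
    than y, or as high and nearer to x0.  Minimality of y confines y - z to a
    set which is finite by Dickson's lemma.  Hence y is joined to x0 by a
    chain of at most mu(I) steps from a finite set. *)
From HB Require Import structures.
From mathcomp Require Import finmap boolp functions monalg.
Require Import Defs.
From mathcomp Require Import all_boot all_order all_algebra.
From mathcomp Require Import classical_sets cardinality.
From mathcomp Require Import zify.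
Import GRing.Theory Num.Theory.
Local Open Scope ring_scope.
Local Open Scope classical_set_scope.

Set Implicit Arguments.
Unset Strict Implicit.
Unset Printing Implicit Defensive.

(** * Dickson's lemma and the finiteness of sets of minimal elements *)

Lemma exists_argmin (T : Type) (A : set T) (f : T -> nat) :
  A !=set0 -> exists2 x, A x & forall y, A y -> (f x <= f y)%N.
Proof.
move=> [x0 Ax0]; apply: contrapT => noMin.
suff H k x : A x -> (k <= f x)%N by have := H (f x0).+1 _ Ax0; rewrite ltnn.
elim: k x => // k IH x Ax; rewrite ltn_neqAle IH // andbT.
apply/eqP => kE; apply: noMin; exists x => // y Ay.
by rewrite -kE; exact: IH.
Qed.

(** Each next index is chosen to minimize [u] on the tail beyond the previous one. *)
Lemma nondecreasing_subseq (u : nat -> nat) : exists s : nat -> nat,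
  {homo s : i j / (i < j)%N} /\ {homo u \o s : i j / (i <= j)%N}.
Proof.
have /boolp.choice[g gP] N : exists i, (N <= i)%N /\
    forall j, (N <= j)%N -> (u i <= u j)%N.
  have [|i Ni iP] := @exists_argmin nat [set i | (N <= i)%N] u.
    by exists N => /=.
  by exists i.
pose s := fix s k := if k is k'.+1 then g (s k').+1 else g 0%N.
have s_lt k : (s k < s k.+1)%N by have [] := gP (s k).+1.
exists s; split; first by apply: homo_ltn => // y x z; exact: ltn_trans.
apply: homo_leq => [//|y x z|k /=]; first exact: leq_trans.
case: k => [|k] /=; first by have [_ ->] := gP 0%N.
by have [_ ->//] := gP (s k).+1; exact: ltn_trans (s_lt k) (s_lt k.+1).
Qed.

Lemma nondecreasing_subseq_all (I : eqType) (l : seq I) (u : I -> nat -> nat) :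
  exists s : nat -> nat, {homo s : i j / (i < j)%N} /\
    forall k, k \in l -> {homo u k \o s : i j / (i <= j)%N}.
Proof.
elim: l => [|k l [s [s_lt sP]]]; first by exists id; split=> // i j.
have [t [t_lt tP]] := nondecreasing_subseq (u k \o s).
exists (s \o t); split=> [i j /t_lt/s_lt//|k'].
rewrite inE => /predU1P[-> //|/sP + i j ij]; apply.
by move: ij; rewrite leq_eqVlt => /predU1P[-> //|/t_lt/ltnW].
Qed.

(** An injective sequence in [A] has a subsequence along which every coordinate is nondecreasing;
    its first two terms serve. *)
Lemma dickson (T : Type) (I : finType) (A : set T) (phi : T -> I -> nat) :
  infinite_set A ->
  exists x y, [/\ A x, A y, x <> y & forall i, (phi x i <= phi y i)%N].
Proof.
move=> /infiniteP/card_leP[f].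
pose g n : T := sval (f (to_setT n)).
have Ag n : A (g n) by rewrite /g; case: (f _) => z /= /set_mem.
have g_inj : injective g.
  move=> i j gij; have fij : f (to_setT i) = f (to_setT j) by exact: val_inj.
  by have /(congr1 val) := inj (mem_set Logic.I) (mem_set Logic.I) fij.
have [s [s_lt sP]] :=
  nondecreasing_subseq_all (enum I) (fun i n => phi (g n) i).
exists (g (s 0%N)), (g (s 1%N)); split=> // [/g_inj s01|i].
  by have := s_lt 0%N 1%N isT; rewrite s01 ltnn.
by apply: sP; rewrite ?mem_enum.
Qed.

(** Distinct minimal elements are incomparable, so Dickson's lemma makes them finite in number;
    minimizing the coordinate sum finds one below any [x]. *)
Lemma finite_minimal (T : Type) (I : finType) (A : set T)
    (phi : T -> I -> nat) : (forall x y, phi x =1 phi y -> x = y) ->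
  exists G : set T, [/\ finite_set G, G `<=` A &
    forall x, A x -> exists2 y, G y & forall i, (phi y i <= phi x i)%N].
Proof.
move=> phi_inj.
exists [set x | A x /\ forall y, A y -> (forall i, (phi y i <= phi x i)%N) ->
  y = x]; split=> [|x []//|x Ax].
  apply: contrapT => /(dickson phi)[x [y [[Ax _] [_ yP] xy le_xy]]].
  exact: xy (yP _ Ax le_xy).
have [|y [Ay le_yx] yP] := @exists_argmin T
  [set y | A y /\ forall i, (phi y i <= phi x i)%N] (fun y => \sum_i phi y i)%N.
  by exists x.
exists y => //; split=> // z Az le_zy; apply: phi_inj => i.
have sumE : (\sum_i phi z i = \sum_i phi y i)%N.
  apply/eqP; rewrite eqn_leq leq_sum //= yP //; split=> // j.
  exact: leq_trans (le_zy j) (le_yx j).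
have [_] := leqif_sum (fun j (_ : true) => leqif_eq (le_zy j)).
by rewrite sumE eqxx => /esym /forallP /(_ i) /eqP.
Qed.

Lemma finite_subsets (T : choiceType) (A : set T) :
  finite_set A -> finite_set [set B | B `<=` A].
Proof.
move=> /finite_fsetP[X ->].
apply: (@sub_finite_set _ _
  ((fun Y : {fset T} => [set` Y]) @` [set` fpowerset X])); last first.
  exact/finite_image/finite_fset.
move=> B /= BX.
have /finite_fsetP[Y BE] : finite_set B by apply: sub_finite_set BX _.
exists Y => //=; rewrite fpowersetE; apply/fsubsetP => y yY.
by apply: BX; rewrite BE.
Qed.

(** * Minimal points of convex sets and their mutual distances *)

Section ConvexSets.
Context (r n : nat) (xi : 'I_n -> {scalar 'rV[int]_r}).
Hypothesis S_positive : positive (semigroup xi).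
Implicit Types (a : 'rV[int]_n) (x y z s : 'rV[int]_r).

Local Notation S := (semigroup xi).
Local Notation T := (convex_set xi).

Definition height x : int := \sum_i xi i x.

Definition minimal_point a y :=
  T a y /\ forall s, S s -> T a (y - s) -> s = 0.

Lemma xiB i x y : xi i (x - y) = xi i x - xi i y.
Proof. exact: raddfB. Qed.

Lemma xiD i x y : xi i (x + y) = xi i x + xi i y.
Proof. exact: raddfD. Qed.

Lemma heightB x y : height (x - y) = height x - height y.
Proof. by rewrite /height -sumrB; apply: eq_bigr => i _; rewrite xiB. Qed.

Lemma heightD x y : height (x + y) = height x + height y.
Proof. by rewrite /height -big_split; apply: eq_bigr => i _; rewrite xiD. Qed.

(** Positivity enters here: [x] and [- x] both lie in [S]. *)
Lemma xi_eq0 x : (forall i, xi i x = 0) -> x = 0.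
Proof.
move=> x0; apply: S_positive; first by apply/forallP => i; rewrite x0.
by exists (- x); [apply/forallP => i; rewrite raddfN /= x0|rewrite subrr].
Qed.

Lemma xi_inj x y : (forall i, xi i x = xi i y) -> x = y.
Proof.
move=> xy; apply/eqP; rewrite -subr_eq0; apply/eqP/xi_eq0 => i.
by rewrite xiB xy subrr.
Qed.

Lemma height_ge0 s : S s -> 0 <= height s.
Proof. by move/forallP => Ss; apply: sumr_ge0. Qed.

Lemma height_eq0 s : S s -> height s = 0 -> s = 0.
Proof.
move/forallP => Ss s0; apply: xi_eq0 => i.
by have /(_ s0 i isT) := @psumr_eq0P _ _ xpredT (xi^~ s) (fun i _ => Ss i).
Qed.

Lemma convex_setD a x s : T a x -> S s -> T a (x + s).
Proof.
move=> /forallP Tx /forallP Ss; apply/forallP => i.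
by have := Tx i; have := Ss i; rewrite xiD; lia.
Qed.

Lemma height_argmin a (A : set 'rV[int]_r) : A `<=` [set x | T a x] ->
  A !=set0 -> exists2 x, A x & forall y, A y -> height x <= height y.
Proof.
move=> AT /(exists_argmin (fun x => absz (height x - \sum_i a 0 i)%R))[x Ax xP].
have geA y : A y -> \sum_i a 0 i <= height y.
  by move=> /AT /forallP Ty; apply: ler_sum.
exists x => // y Ay.
by have := xP y Ay; have := geA y Ay; have := geA x Ax; lia.
Qed.

Lemma minimal_point_below a x : T a x ->
  exists2 y, minimal_point a y & S (x - y).
Proof.
move=> Tx; have [||y [Ty Sy] yP] :=
  @height_argmin a [set y | T a y /\ S (x - y)].
- by move=> y [].
- by exists x; split; rewrite // subrr; apply/forallP => i; rewrite raddf0.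
exists y => //; split=> // s Ss Ts; apply: height_eq0 => //.
have : height y <= height (y - s).
  apply: yP; split=> //; apply/forallP => i.
  move/forallP/(_ i): Sy; move/forallP/(_ i): Ss.
  by rewrite !xiB; lia.
by rewrite heightB; have := height_ge0 Ss; lia.
Qed.

Lemma convex_setE a x :
  T a x <-> exists2 y, minimal_point a y & S (x - y).
Proof.
split=> [/minimal_point_below//|[y [Ty _] Sxy]].
by rewrite -(subrK y x) addrC convex_setD.
Qed.

(** Comparing the positive parts of [z] and [t], and those of [- z] and [- t], says that [z] lies
    between 0 and [t]: the conformal order. *)
Definition pos_part (z : int) : nat := if z is Posz k then k else 0.

Lemma leq_pos_part (z t : int) :
  (pos_part z <= pos_part t)%N = (z <= t) || (z <= 0).
Proof. by case: z => u; case: t => v /=; lia. Qed.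

(** If [y] dominates [x] in the coordinates [phi], each [xi i (y - x)] is 0 or between 0 and
    [xi i y], so [f = y - x] contradicts the irreducibility of [y]. *)
Lemma finite_irreducible (e : 'rV[int]_r) : finite_set [set x | S (x + e) /\
  forall f, S f -> (forall i, xi i f = 0 \/ xi i f <= xi i x) -> f = 0].
Proof.
pose phi x (j : 'I_n * bool) :=
  pos_part (if j.2 then xi j.1 (x + e) else - xi j.1 x).
apply: contrapT => /(dickson phi)[x [y [[Sx _] [Sy yP] xy le_xy]]].
have yxE i : xi i x = xi i y \/ 0 <= xi i x <= xi i y.
  move: (le_xy (i, true)) (le_xy (i, false)).
  move/forallP/(_ i): Sx; move/forallP/(_ i): Sy.
  by rewrite /phi /= !leq_pos_part !xiD; lia.
apply: xy; apply/esym/eqP; rewrite -subr_eq0; apply/eqP/yP => [|i].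
  by apply/forallP => i; rewrite xiB; have := yxE i; lia.
by rewrite xiB; have := yxE i; lia.
Qed.

(* Graver elements: finitely many steps suffice to start a walk from y to y + d
   along which each form xi_i, and their sum, moves monotonically. *)
Lemma finite_conformal : exists G : set 'rV[int]_r,
  [/\ finite_set G, G `<=` [set e | e != 0] & forall d, d != 0 ->
   exists2 e, G e & [/\ height d <= 0 -> height e <= 0 &
     forall i, 0 <= xi i e <= xi i d \/ xi i d <= xi i e <= 0]].
Proof.
pose form (o : option 'I_n) x := if o is Some i then xi i x else height x.
pose phi x (j : option 'I_n * bool) :=
  pos_part (if j.2 then form j.1 x else - form j.1 x).
have [x y xy|G [Gfin Gn0 GP]] :=
    @finite_minimal _ _ [set e | e != 0] phi.
  apply: xi_inj => i; have := xy (Some i, true); have := xy (Some i, false).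
  rewrite /phi /=.
  by case: (xi i x) => [[|u]|u]; case: (xi i y) => [[|v]|v] /=; lia.
exists G; split=> // d /GP[e Ge le_ed]; exists e => //; split=> [|i].
  move: (le_ed (None, true)) (le_ed (None, false)).
  by rewrite /phi /= !leq_pos_part; lia.
move: (le_ed (Some i, true)) (le_ed (Some i, false)).
by rewrite /phi /= !leq_pos_part; lia.
Qed.

Definition dist x y : nat := (\sum_i `|xi i (x - y)%R|)%N.

(* If each xi_i f is 0 or at most xi_i (y - z), then each xi_i (y - f) is at
   least xi_i y or xi_i z, so y - f lies in T and f = 0: hence y - z belongs to
   a set of finite_irreducible. *)
Lemma descent : exists2 D : set 'rV[int]_r, finite_set D &
  forall a x0 y, T a x0 -> minimal_point a y -> y != x0 ->
    height x0 <= height y -> exists z, [/\ minimal_point a z, D (y - z) &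
      height z < height y \/ height z = height y /\ (dist z x0 < dist y x0)%N].
Proof.
have [G [Gfin Gn0 GP]] := finite_conformal.
exists (\bigcup_(e in G) [set x | S (x + e) /\
  forall f, S f -> (forall i, xi i f = 0 \/ xi i f <= xi i x) -> f = 0]).
  by apply: bigcup_finite => // e _; exact: finite_irreducible.
move=> a x0 y /forallP Tx0 [/forallP Ty yP] yx0 le_x0y.
have [|e Ge [eh eP]] := GP (x0 - y); first by rewrite subr_eq0 eq_sym.
(* Each [xi i (y + e)] lies between [xi i y] and [xi i x0], so [y + e] stays in [T a]. *)
have [|z [Tz zP] Sz] := @minimal_point_below a (y + e).
  apply/forallP => i; rewrite xiD.
  by have := eP i; have := Ty i; have := Tx0 i; rewrite xiB; lia.
exists z; split=> //.
  exists e => //; split=> [|f Sf fP]; first by rewrite addrAC.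
  apply: yP => //; apply/forallP => i; have := fP i; have := Ty i.
  by move/forallP/(_ i): Tz; rewrite !xiB; lia.
have := height_ge0 Sz; move: eh; rewrite !heightB heightD => eh h0.
have [hzy|/negP hzy] := boolP (height z < height y); [by left|right].
have hzyE : height z = height y by lia.
(* At equal heights, [y + e - z] is an element of [S] of height 0. *)
split=> //; have zE : z = y + e.
  apply/esym/eqP; rewrite -subr_eq0; apply/eqP; apply: height_eq0 => //.
  by rewrite heightB heightD; lia.
(* As [e] is conformal to [x0 - y], absolute values add up in every form; [e != 0] makes the drop in
   distance strict. *)
have distE i : (`|xi i (y - x0)%R| = `|xi i (z - x0)%R| + `|xi i e|)%N.
  by have := eP i; rewrite zE !(xiB, xiD); lia.
rewrite /dist (eq_bigr _ (fun i _ => distE i)) big_split /= -[ltnLHS]addn0.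
rewrite ltn_add2l lt0n; apply/negP => /eqP; apply/eqP; move: (Gn0 _ Ge) => /=.
apply: contraNneq => /eqP; rewrite sum_nat_eq0 => /forallP e0.
by apply/eqP/xi_eq0 => i; have := e0 i; rewrite /=; lia.
Qed.

Fixpoint sums (D : set 'rV[int]_r) k : set 'rV[int]_r :=
  if k is k'.+1 then [set x + y | x in D & y in sums D k'] else [set 0].

Lemma finite_sums D k : finite_set D -> finite_set (sums D k).
Proof. by move=> Dfin; elim: k => //= k IH; exact: finite_image2. Qed.

(** The lexicographic progress made by [descent]; being a strict order, it rules out repetitions in
    a chain. *)
Definition descends x0 : rel 'rV[int]_r := fun y z =>
  (height z < height y) ||
  (height z == height y) && (dist z x0 < dist y x0)%N.

Lemma descends_trans x0 : transitive (descends x0).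
Proof. by move=> y x z; rewrite /descends; lia. Qed.

Lemma descends_irr x0 : irreflexive (descends x0).
Proof. by move=> x; rewrite /descends; lia. Qed.

Lemma finite_minimal_points_upto_shift m :
  exists2 W : set 'rV[int]_r, finite_set W &
  forall a, (forall l, uniq l -> (forall y, y \in l -> minimal_point a y) ->
     (size l <= m)%N) ->
  exists x0, forall y, minimal_point a y -> W (y - x0).
Proof.
have [D Dfin DP] := descent.
(* Adjoining 0 to [D] lets chains with fewer than [m] steps be padded. *)
exists (sums (0 |` D) m); first by apply: finite_sums; rewrite finite_setU.
move=> a size_le.
have [[x Tx]|T0] := pselect (exists x, T a x); last first.
  by exists 0 => y [Ty _]; case: T0; exists y.
have [//||x0 Tx0 x0P] := @height_argmin a [set x | T a x]; first by exists x.
exists x0.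
pose chain y l := [/\ path (descends x0) y l, last y l = x0,
  forall z, z \in y :: l -> minimal_point a z &
  sums (0 |` D) (size l) (y - x0)].
have mem0 k : sums (0 |` D) k 0.
  by elim: k => //= k IH; exists 0; [left|exists 0; rewrite ?addr0].
have mono k j x' : (k <= j)%N -> sums (0 |` D) k x' -> sums (0 |` D) j x'.
  elim: k j x' => [|k IH] [|j] x' //= kj.
    by move=> ->; exact: (mem0 j.+1).
  by move=> [u Du [v Dv <-]]; exists u => //; exists v => //; exact: IH Dv.
suff chainP y : minimal_point a y -> exists l, chain y l.
  move=> y /chainP[l [yl _ lP ylD]]; apply: mono ylD.
  (* The chain consists of distinct minimal points, hence of at most [m], and has fewer than [m]
     steps. *)
  apply: ltnW; apply: (size_le (y :: l)) => //.
  by apply: (sorted_uniq (@descends_trans x0) (@descends_irr x0)).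
(* Nested induction: on the height above [x0], then at constant height on the distance to [x0]. *)
have [k] := ubnP (absz (height y - height x0)%R).
elim: k y => // k IHk y; have [q] := ubnP (dist y x0).
elim: q y => // q IHq y le_q le_k yP.
have [yE|yx0] := eqVneq y x0.
  exists [::]; rewrite /chain -yE; split=> //= [z|]; last by rewrite subrr.
  by rewrite inE => /eqP ->.
have x0y : height x0 <= height y by apply: x0P; case: yP.
have [z [zP Dyz yz]] := DP _ _ _ Tx0 yP yx0 x0y.
have x0z : height x0 <= height z by apply: x0P; case: zP.
have [l [zl lastl lP lD]] : exists l, chain z l.
  by case: yz => [yz|[yzE yz]]; [apply: IHk|apply: IHq] => //; lia.
exists (z :: l); split=> //=.
- by rewrite zl andbT /descends; lia.
- by move=> t; rewrite inE => /predU1P[->|/lP].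
- exists (y - z); first by right.
  by exists (z - x0); rewrite // addrA subrK.
Qed.
End ConvexSets.

(** * Minimal points and numbers of generators *)

Lemma mcoeff_mul (K : fieldType) (G : zmodType) (U V : pred G)
    (f g : grpalg K G) (y : G) :
    f \in supported U -> g \in supported V ->
    (forall u v, U u -> V v -> u + v = y -> u = 0) ->
  mcoeff y (f * g) = mcoeff 0 f * mcoeff y g.
Proof.
move=> fU gV uvy; set c := mcoeff 0 f.
(* Once the constant term is split off, the rest of [f] has no term in degree 0, so its product with
   [g] has none in degree [y]. *)
have -> : f * g = c *: g + (f - c *: 1) * g.
  by rewrite mulrBl -scalerAl mul1r addrC subrK.
rewrite mcoeffD mcoeffZ.
have : (f - c *: 1) * g \in supported (fun x => x != y).
  apply: (@supportedM _ _ (fun u => U u && (u != 0)) V) gV => [u v|].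
    by move=> /andP[Uu u0] Vv; apply: contraNneq u0 => /(uvy _ _ Uu Vv) ->.
  apply/supportedP => u; rewrite mcoeffB mcoeffZ.
  have -> : mcoeff u (1 : grpalg K G) = (0 == u)%:R by exact: mcoeffU.
  have [<-|u0] := eqVneq 0 u; first by rewrite mulr1 subrr eqxx.
  by rewrite mulr0 subr0 andbT => /(supportedP _ _ fU).
move=> /supportedP /(_ y) yP; case: eqP yP => [-> _|_ /(_ isT)]; last first.
  by rewrite eqxx.
by rewrite addr0.
Qed.

(** Writing the monomials at the minimal points in the [k] generators and reading coefficients at
    these points factors an identity matrix of size [size l] through [K^k]. *)
Lemma leq_minimal_points (K : fieldType) (r n : nat)
    (xi : 'I_n -> {scalar 'rV[int]_r}) (a : 'rV[int]_n) k l :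
    generated_by (convex_ideal K xi a) k -> uniq l ->
    (forall y, y \in l -> minimal_point xi a y) ->
  (size l <= k)%N.
Proof.
move=> [g gP] l_uniq lP; pose y (i : 'I_(size l)) := l`_i.
have yP i : minimal_point xi a (y i) by apply/lP/mem_nth.
have monP i :
    (<< y i >> : grpalg K _) \in convex_ideal_pred (K := K) (xi := xi) a.
  apply/supportedP => x; rewrite mcoeffU.
  by have [<- _|_] := eqVneq (y i) x; [case: (yP i)|rewrite eqxx].
have /boolp.choice[c cP] i := 
  gP (exist (fun f : ambient K xi => f \in convex_ideal_pred a) _ (monP i)).
pose A := \matrix_(i < size l, j < k) mcoeff 0 (val (c i j)).
pose B := \matrix_(j < k, i < size l) mcoeff (y i) (val (g j)).
suff AB1 : A *m B = 1%:M by have := mulmx_max_rank A B; rewrite AB1 mxrank1.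
apply/matrixP => i i'; rewrite !mxE.
have -> : (i == i')%:R = mcoeff (y i') (<< y i >> : grpalg K _).
  by rewrite mcoeffU /y nth_uniq.
have -> : << y i >> = val (\sum_(j < k) c i j *: g j) by rewrite -cP.
rewrite !raddf_sum /=; apply: eq_bigr => j _; rewrite !mxE.
(* Minimality of [y i'] leaves only [s = 0] in a decomposition [s + t = y i']. *)
symmetry; apply: mcoeff_mul (valP (c i j)) (valP (g j)) _ => s t Ss Tt st.
by case: (yP i') => _; apply=> //; rewrite -st addrC addKr.
Qed.

(** * Translations as module isomorphisms *)

Section Shift.
Context (K : fieldType) (r n : nat) (xi : 'I_n -> {scalar 'rV[int]_r}).
Context (a b : 'rV[int]_n) (z : 'rV[int]_r).
Hypothesis shift_ab : forall x, convex_set xi a x -> convex_set xi b (z + x).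

Lemma shift_subproof (f : convex_ideal K xi a) :
  (<< z >> : grpalg K _) * val f \in convex_ideal_pred (K := K) (xi := xi) b.
Proof.
apply: (@supportedM _ _ (pred1 z) (convex_set xi a)) (valP f).
  by move=> x y /eqP ->; exact: shift_ab.
apply/supportedP => x; rewrite mcoeffU /=.
by have [_|_] := eqVneq z x; rewrite ?eqxx.
Qed.

Definition shift (f : convex_ideal K xi a) : convex_ideal K xi b :=
  exist (fun h : ambient K xi => h \in convex_ideal_pred b) _
    (shift_subproof f).

Lemma shift_is_linear : linear shift.
Proof.
move=> s f g; apply: val_inj => /=.
by rewrite [LHS](@mulrDr (grpalg K _)) (@mulrCA (grpalg K _)).
Qed.

HB.instance Definition _ := GRing.isLinear.Build (semigroup_ring K xi)
  (convex_ideal K xi a) (convex_ideal K xi b) *:%R shift shift_is_linear.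

End Shift.

Lemma shiftK (K : fieldType) (r n : nat) (xi : 'I_n -> {scalar 'rV[int]_r})
    (a b : 'rV[int]_n) (z : 'rV[int]_r)
    (ab : forall x, convex_set xi a x -> convex_set xi b (z + x))
    (ba : forall x, convex_set xi b x -> convex_set xi a (- z + x)) :
  cancel (@shift K r n xi a b z ab) (@shift K r n xi b a (- z) ba).
Proof.
move=> f; apply: val_inj => /=; rewrite (@mulrA (grpalg K _)).
rewrite [X in X * _](ga_mulUU 1 1) mulr1 addNr.
exact: (@mul1r (grpalg K _)).
Qed.

Lemma mod_isomorphic_shift (K : fieldType) (r n : nat)
    (xi : 'I_n -> {scalar 'rV[int]_r}) (a b : 'rV[int]_n) (z : 'rV[int]_r) :
    (forall x, convex_set xi b (z + x) = convex_set xi a x) ->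
  mod_isomorphic (convex_ideal K xi a) (convex_ideal K xi b).
Proof.
move=> abE.
have ab x : convex_set xi a x -> convex_set xi b (z + x) by rewrite abE.
have ba x : convex_set xi b x -> convex_set xi a (- z + x).
  by rewrite -abE addNKr.
(* [shiftK] inverts the shift by [- z] by one by [- - z], which is not convertible to [z]. *)
have ab' x : convex_set xi a x -> convex_set xi b (- - z + x).
  by rewrite opprK => /ab.
exists (@shift K r n xi a b z ab).
exists (@shift K r n xi b a (- z) ba); first exact: shiftK.
move=> f; rewrite -[RHS](shiftK ba ab' f); apply: val_inj => /=.
by rewrite opprK.
Qed.

(** * Counting the isomorphism classes *)

Lemma mod_isomorphic_trans (R : nzRingType) (M N P : lmodType R) :
  mod_isomorphic M N -> mod_isomorphic N P -> mod_isomorphic M P.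
Proof.
move=> [f f_bij] [g g_bij]; exists (g \o f : {linear M -> P}).
exact: bij_comp.
Qed.

Theorem theorem6p2 (K : fieldType) (r n : nat)
    (xi : 'I_n -> {scalar 'rV[int]_r})
    (xi_neq0 : forall i, exists x, xi i x != 0)
    (S_positive : positive (semigroup xi))
    (gpS : gp (semigroup xi) = [set: 'rV[int]_r])
    (m : nat) :
  finite_set [set C : set (set (grpalg K 'rV[int]_r)) |
    exists a : 'rV[int]_n,
      (exists2 k, mu_is (convex_ideal K xi a) k & (k <= m)%N)
      /\ C = convex_iso_class K xi a].
Proof.
have [W Wfin WP] := finite_minimal_points_upto_shift S_positive m.
pose generates (F : set 'rV[int]_r) a x0 := forall x : 'rV[int]_r,
  convex_set xi a x <-> exists2 w, F w & semigroup xi (x - (w + x0)).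
(* [class] depends on [F] alone, not on a chosen [a], so the finitely many subsets of [W] yield
   finitely many classes. *)
pose class (F : set 'rV[int]_r) := [set J | exists a b x0, [/\ generates F a x0,
  J = [set f | f \in convex_ideal_pred (K := K) (xi := xi) b] &
  mod_isomorphic (convex_ideal K xi a) (convex_ideal K xi b)]].
apply: sub_finite_set (finite_image class (finite_subsets Wfin)).
move=> _ [a [[k [ak _] le_km] ->]].
have [|x0 x0P] := WP a.
  move=> l l_uniq lP; apply: leq_trans le_km.
  exact: leq_minimal_points ak l_uniq lP.
exists [set w | minimal_point xi a (w + x0)].
  by move=> w /x0P; rewrite addrK.
have gen_a : generates [set w | minimal_point xi a (w + x0)] a x0.
  move=> x; split=> [/(minimal_point_below S_positive)[y yP Sxy]|].
    by exists (y - x0); rewrite /= subrK.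
  by move=> [w wP Sw]; apply/(convex_setE S_positive); exists (w + x0).
apply/seteqP; split=> J; last first.
  by move=> [b JE ab]; exists a, b, x0.
move=> [a' [b [x0' [gen_a' JE a'b]]]]; exists b => //.
apply: mod_isomorphic_trans a'b.
(* The sets of [a] and [a'] are generated by the translates of one set by [x0] and [x0'], so
   translation by [x0' - x0] carries the first to the second. *)
have xE x w : x0' - x0 + x - (w + x0') = x - (w + x0).
  rewrite -[x0' - x0 + x]addrA [x0' + _]addrC [w + x0']addrC addrKA.
  by rewrite [- x0 + x]addrC -addrA -opprD [x0 + w]addrC.
apply: (@mod_isomorphic_shift _ _ _ _ _ _ (x0' - x0)) => x.
apply/idP/idP => [/gen_a'|/gen_a] [w wF Sw]; [apply/gen_a|apply/gen_a'].
  by exists w; rewrite // -xE.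
by exists w; rewrite // xE.
Qed.
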